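(* If a position in a simple stone-placing game has a game value (for one of the players), then it is intrinsically local (for that player), and consequently the game value is finite.
   Context: Simple stone-placing game: specified by a set $X$ (finite or infinite) of board locations and two families $\mathcal{R},\mathcal{B}\subseteq\mathcal{P}(X)$ of sufficient winning configurations, such that there are no disjoint sets $R\in\mathcal{R}$ and $B\in\mathcal{B}$. Players Red and Blue take turns, each placing one stone of their own color on an unoccupied location; stones are never moved or removed. Red strives to have red stones at every location of some $R\in\mathcal{R}$, Blue to have blue stones at every location of some $B\in\mathcal{B}$ (extra stones of one's own color are allowed). A position consists of disjoint sets $X_R,X_B\subseteq X$ of locations occupied by red, respectively blue, stones, together with the information whose turn it is. The winning condition for Red is that $X_R\supseteq R$ for some $R\in\mathcal{R}$, and for Blue that $X_B\supseteq B$ for some $B\in\mathcal{B}$. Play lasts $\omega$ many moves or until the board is full. Game value for a player $P$ (an ordinal, defined by recursion for some positions): a position has value $0$ if the game is already won for $P$, i.e. the stones of $P$ already on the board fulfill $P$'s winning condition (so that no subsequent moves can prevent the win). If the position is not already won, it is $P$'s turn, and $P$ has a move to a position with a value, then with $\alpha$ the minimal value of such a position, the value is $\alpha+1$. If the position is not already won, it is the opponent's turn, there is at least one legal move, and every legal move leads to a position with a value, then the value is the supremum of those values. Positions not assigned a value in this way have no game value for $P$. Intrinsically local: a position is intrinsically local for $P$ if there is a finite set $D\subseteq X$ such that, from this position, $P$ can win by playing only on locations of $D$ and paying attention only to the opponent's moves in $D$ (opponent's moves outside $D$ are ignored, and may be treated as imaginary moves in $D$); the win is achieved, with such play, at the latest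 when $D$ is filled with stones. *)

(* Defs.v *)
(* MathComp world: sets are the [set T] of mathcomp.classical.classical_sets,
   finiteness of a set is [finite_set] of mathcomp.classical.cardinality. *)
From mathcomp Require Import all_boot.
From mathcomp Require Import boolp classical_sets cardinality.

Set Implicit Arguments.
Unset Strict Implicit.
Unset Printing Implicit Defensive.

Local Open Scope classical_set_scope.

(* Ordinals are represented by well-founded trees: [OLim f] denotes the least
   ordinal strictly above all the [f i].  Distinct trees may denote the same
   ordinal, so equality of ordinals is [oeq], not Leibniz equality. *)
Inductive Ord : Type := OLim (A : Type) (f : A -> Ord).

Fixpoint ole (a b : Ord) : Prop :=
  match a, b with
  | OLim A f, OLim B g => forall i : A, exists j : B, ole (f i) (g j)
  end.

Definition olt (a b : Ord) : Prop :=
  match b with OLim B g => exists j : B, ole a (g j) end.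

Definition oeq (a b : Ord) : Prop := ole a b /\ ole b a.

Definition ozero : Ord := OLim (fun i : Empty_set => match i with end).

Definition osucc (a : Ord) : Ord := OLim (fun _ : unit => a).

Definition ord_of_nat (n : nat) : Ord := iter n osucc ozero.

Definition finite_ord (a : Ord) : Prop := exists n : nat, oeq a (ord_of_nat n).

Definition is_least (S : set Ord) (a : Ord) : Prop :=
  S a /\ forall b, S b -> ole a b.

Definition is_sup (S : set Ord) (a : Ord) : Prop :=
  is_least [set b | forall c, S c -> ole c b] a.

Inductive player : Set := Red | Blue.

Definition opponent (P : player) : player :=
  match P with Red => Blue | Blue => Red end.

Record game (X : Type) : Type := Game {
  winning : player -> set (set X);
  no_disjoint_wins : forall R B : set X,
    winning Red R -> winning Blue B -> R `&` B <> set0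
}.

(* Any two disjoint sets of stones are allowed: a position need not be reachable
   from the empty board, and may contain infinitely many stones. *)
Record position (X : Type) : Type := Position {
  stones : player -> set X;
  turn : player;
  stones_disjoint : stones Red `&` stones Blue = set0
}.

Definition occupied (X : Type) (p : position X) : set X :=
  stones p Red `|` stones p Blue.

Definition won (X : Type) (G : game X) (P : player) (p : position X) : Prop :=
  exists2 W : set X, winning G P W & W `<=` stones p P.

Definition move (X : Type) (p : position X) (x : X) (q : position X) : Prop :=
  [/\ ~ occupied p x,
      stones q (turn p) = x |` stones p (turn p),
      stones q (opponent (turn p)) = stones p (opponent (turn p)) &
      turn q = opponent (turn p)].

(* The ordinals [a] such that some legal move from [p] leads to a position to
   which [V] gives the value [a]. *)
Definition next_values (X : Type) (V : position X -> Ord -> Prop)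
    (p : position X) : set Ord :=
  [set a | exists x q, move p x q /\ V q a].

(* [V p a] is read "p has value a"; the three disjuncts are the three clauses of
   the recursion, and [p] has no value when no [a] satisfies [V p a]. *)
Definition value_rules (X : Type) (G : game X) (P : player)
    (V : position X -> Ord -> Prop) : Prop :=
  forall p a, V p a <->
    [\/ won G P p /\ oeq a ozero,
        [/\ ~ won G P p, turn p = P &
            exists2 b, is_least (next_values V p) b & oeq a (osucc b)] |
        [/\ ~ won G P p, turn p = opponent P,
            exists x q, move p x q,
            forall x q, move p x q -> exists b, V q b &
            is_sup (next_values V p) a]].

(* The recursive clauses have exactly one solution ([value_rules_unique] and
   [game_value_rules] below), so the choice of [V] is immaterial. *)
Definition game_value (X : Type) (G : game X) (P : player)
    (p : position X) (a : Ord) : Prop :=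
  exists2 V, value_rules G P V & V p a.

(* What a player attending only to [D] sees of an opponent's move at [y]: its
   location if it is in [D], and otherwise only that a move was made. *)
Definition observe (X : Type) (D : set X) (y : X) : option X :=
  if pselect (D y) then Some y else None.

(* A strategy paying attention only to the opponent's moves in [D] is a function
   of the list of observed opponent's moves, in chronological order; it may return
   [None], meaning that it prescribes nothing.
   [play P D s p h q]: from [p], with [P] following [s] and the opponent moving
   anywhere on the board, the position [q] can be reached with observations [h]. *)
Inductive play (X : Type) (P : player) (D : set X)
    (s : seq (option X) -> option X) (p : position X) :
    seq (option X) -> position X -> Prop :=
| play_start : play P D s p [::] p
| play_own h q x r :
    play P D s p h q -> turn q = P -> s h = Some x -> move q x r ->
    play P D s p h r
| play_opponent h q y r :
    play P D s p h q -> turn q = opponent P -> move q y r ->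
    play P D s p (rcons h (observe D y)) r.

(* The strategy plays only on [D], provides a legal move whenever it is the turn
   of [P] and [P] has not won yet, and [P] has won once [D] is filled with stones.
   Since [D] is finite, it is filled after finitely many moves of [P]. *)
Definition intrinsically_local (X : Type) (G : game X) (P : player)
    (p : position X) : Prop :=
  exists2 D : set X, finite_set D &
  exists s : seq (option X) -> option X, forall h q, play P D s p h q ->
    [/\ forall x, s h = Some x -> D x,
        turn q = P -> ~ won G P q -> exists2 x, s h = Some x & ~ occupied q x &
        D `<=` occupied q -> won G P q].

Lemma ole_refl a : ole a a.
Proof. by elim: a => A f IH /= i; exists i. Qed.

Lemma ole_trans b a c : ole a b -> ole b c -> ole a c.
Proof.
elim: a b c => A f IH [B g] [C h] /= fg gh i.
have [j fij] := fg i; have [k gjk] := gh j.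
by exists k; exact: IH fij gjk.
Qed.

Lemma olt_ole_trans b a c : olt a b -> ole b c -> olt a c.
Proof.
case: b c => [B g] [C h] /= [j aj] gh; have [k jk] := gh j.
by exists k; exact: ole_trans aj jk.
Qed.

Lemma ole_olt_trans b a c : ole a b -> olt b c -> olt a c.
Proof. by case: c => C h ab [k bk]; exists k; exact: ole_trans ab bk. Qed.

Lemma oleP (A : Type) (f : A -> Ord) b :
  ole (OLim f) b <-> forall i, olt (f i) b.
Proof. by case: b => B g; split=> h i; exact: (h i). Qed.

Lemma olt_ole a b : olt a b -> ole a b.
Proof.
elim: a b => A f IH [B g] [j fj]; apply/oleP => i; exists j.
have /oleP/(_ i) := fj; exact: IH.
Qed.

Lemma ole_succ a b : ole (osucc a) b <-> olt a b.
Proof. by rewrite /osucc oleP; split => [/(_ tt)|]. Qed.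

Lemma olt_succ a : olt a (osucc a).
Proof. by exists tt; exact: ole_refl. Qed.

Lemma ole0 a : ole ozero a.
Proof. by case: a => A f; case. Qed.

Lemma ole_total a b : (ole a b \/ olt b a) /\ (olt a b \/ ole b a).
Proof.
elim: a b => A f IHa; elim=> B g IHb; split.
- have [h|/existsNP[i ni]] := pselect (forall i, olt (f i) (OLim g)).
    by left; apply/oleP.
  by right; exists i; case: (IHa i (OLim g)) => _ [|].
- have [h|/forallNP h] := pselect (exists j, ole (OLim f) (g j)).
    by left.
  right; apply/oleP => j.
  by case: (IHb j) => -[|//] /(h j).
Qed.

Lemma olt_wf : well_founded olt.
Proof.
suff H a : forall b, ole b a -> Acc olt b by move=> a; apply: (H a); exact: ole_refl.
elim: a => A f IH b bf; constructor => c cb.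
by have [i ci] := olt_ole_trans cb bf; exact: IH ci.
Qed.

Lemma exists_least (S : set Ord) a : S a -> exists2 b, is_least S b & ole b a.
Proof.
elim/(well_founded_ind olt_wf): a => a IH Sa.
have [[b [Sb ba]]|/forallNP h] := pselect (exists b, S b /\ olt b a).
  by have [c lc cb] := IH b ba Sb; exists c => //; exact/(ole_trans cb)/olt_ole.
exists a; last exact: ole_refl.
split=> // b Sb; have [_ [ba|//]] := ole_total b a.
by case: (h b).
Qed.

Lemma is_least_oeq S a b : is_least S a -> is_least S b -> oeq a b.
Proof. by move=> [Sa la] [Sb lb]; split; [exact: la|exact: lb]. Qed.

Lemma oeq_sym a b : oeq a b -> oeq b a.
Proof. by case. Qed.

Lemma oeq_trans b a c : oeq a b -> oeq b c -> oeq a c.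
Proof.
move=> [ab ba] [bc cb].
by split; [exact: ole_trans ab bc|exact: ole_trans cb ba].
Qed.

Lemma osucc_oeq a b : oeq a b -> oeq (osucc a) (osucc b).
Proof. by move=> [ab ba]; split; move=> i; exists i. Qed.

Lemma opponent_neq P : opponent P <> P.
Proof. by case: P. Qed.

Lemma opponentK P : opponent (opponent P) = P.
Proof. by case: P. Qed.

Lemma turnP P Q : P = Q \/ P = opponent Q.
Proof. by case: P; case: Q; [left|right|right|left]. Qed.

Section Values.
Variables (X : Type) (G : game X) (P : player).
Implicit Types (p q : position X) (V : position X -> Ord -> Prop).

Lemma value_oeq V p a b : value_rules G P V -> oeq a b -> V p a -> V p b.
Proof.
move=> rV ab /rV H; apply/rV; case: H => [[wp a0]|[nw t [c lc ac]]|[nw t ex al sa]].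
- by apply: Or31; split=> //; exact: oeq_trans (oeq_sym ab) a0.
- apply: Or32; split=> //; exists c => //; exact: oeq_trans (oeq_sym ab) ac.
- apply: Or33; split=> //; case: sa => ub le; case: ab => ab ba; split.
    by move=> c /ub ca; exact: ole_trans ca ab.
  by move=> c /le ac; exact: ole_trans ba ac.
Qed.

Lemma value_fun V p a b : value_rules G P V -> V p a -> V p b -> oeq a b.
Proof.
move=> rV /rV H /rV K.
case: H => [[wp a0]|[nw t [c lc ac]]|[nw t _ _ sa]];
  case: K => [[wp' b0]|[nw' t' [d ld bd]]|[nw' t' _ _ sb]] //.
- exact: oeq_trans a0 (oeq_sym b0).
- apply: oeq_trans ac _; apply: oeq_trans _ (oeq_sym bd).
  exact/osucc_oeq/(is_least_oeq lc ld).
- by case: (@opponent_neq P); congruence.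
- by case: (@opponent_neq P); congruence.
- exact: is_least_oeq sa sb.
Qed.

Lemma value_rules_sub V V' : value_rules G P V -> value_rules G P V' ->
  forall a p, V p a -> V' p a.
Proof.
move=> rV rV'.
suff H a p : V p a <-> V' p a by move=> a p /H.
elim/(well_founded_ind olt_wf): a p => a IH p.
have own W W' q b : value_rules G P W -> value_rules G P W' ->
    (forall c, olt c a -> forall q, W q c <-> W' q c) ->
    ole b a -> won G P q \/ turn q = P -> W q b -> W' q b.
  move=> rW rW' E ba tq /rW[[wq b0]|[nw t [c [[x [r [m Wc]]] lc] bc]]|[nw t _ _ _]].
  - by apply/rW'; apply: Or31.
  - have cb : olt c b by apply: olt_ole_trans (olt_succ c) _; case: bc.
    have ca := olt_ole_trans cb ba.
    apply/rW'; apply: Or32; split=> //; exists c => //; split.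
      by exists x, r; split=> //; apply/E.
    move=> d [y [u [m' W'd]]].
    have [ad|da] := (ole_total a d).1; last first.
      by apply: lc; exists y, u; split=> //; apply/E.
    exact/olt_ole/(olt_ole_trans ca).
  - by case: tq => // tq; case: (@opponent_neq P); congruence.
have half W W' : value_rules G P W -> value_rules G P W' ->
    (forall c, olt c a -> forall q, W q c <-> W' q c) -> W p a -> W' p a.
  move=> rW rW' E Wp.
  have [wp|nw] := pselect (won G P p).
    by apply: own Wp => //; [exact: ole_refl|left].
  have [t|t] := turnP (turn p) P.
    by apply: own Wp => //; [exact: ole_refl|right].
  move/rW: Wp => [[//]|[_ t' _]|[_ _ ex al [ub le]]].
    by case: (@opponent_neq P); congruence.
  have WW' x q b : move p x q -> W q b -> W' q b.
    move=> m Wq; apply: own (Wq) => //; first by apply: ub; exists x, q.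
    by right; case: m => _ _ _ ->; rewrite t opponentK.
  have W'W x q b : move p x q -> W' q b -> W q b.
    move=> m W'q; have [c Wc] := al x q m.
    exact: value_oeq rW (value_fun rW' (WW' x q c m Wc) W'q) Wc.
  apply/rW'; apply: Or33; split=> //.
    by move=> x q m; have [b Wb] := al x q m; exists b; exact: WW' m Wb.
  split.
    by move=> c [x [q [m /(W'W x q c m) Wc]]]; apply: ub; exists x, q.
  move=> c cub; apply: le => d [x [q [m Wd]]]; apply: cub.
  by exists x, q; split=> //; exact: WW' m Wd.
split; [apply: (half V V') => //|apply: (half V' V) => //] => c ca q.
by split=> /(IH c ca q).
Qed.

Lemma value_rules_unique V V' : value_rules G P V -> value_rules G P V' -> V = V'.
Proof.
move=> rV rV'; apply/funext => p; apply/funext => a; apply/propext.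
by split; exact: value_rules_sub.
Qed.

Inductive value_le : position X -> Ord -> Prop :=
| value_le_won p a : won G P p -> value_le p a
| value_le_own p x q a b : turn p = P -> move p x q -> value_le q b ->
    olt b a -> value_le p a
| value_le_opponent p a : turn p = opponent P -> (exists x q, move p x q) ->
    (forall x q, move p x q -> value_le q a) -> value_le p a.

Lemma value_le_trans p a b : value_le p a -> ole a b -> value_le p b.
Proof.
move=> H; elim: H b => {p a} [p a wp|p x q a c t m H _ ca|p a t ex H IH] b ab.
- exact: value_le_won.
- by apply: value_le_own t m H _; exact: olt_ole_trans ca ab.
- by apply: value_le_opponent => // x q m; exact: IH m _ ab.
Qed.

Lemma value_le_ownE p b : ~ won G P p -> turn p = P -> value_le p b ->
  exists x q c, [/\ move p x q, is_least (value_le q) c & olt c b].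
Proof.
move=> nw t H; case: H nw t => {p b} [p b wp|p x q b c _ m Hq cb|p b t _ _] nw t' //.
- have [d ld dc] := exists_least Hq.
  by exists x, q, d; split=> //; exact: ole_olt_trans dc cb.
- by case: (@opponent_neq P); congruence.
Qed.

Lemma value_le_opponentE p b : ~ won G P p -> turn p = opponent P ->
  value_le p b ->
  (exists x q, move p x q) /\ (forall x q, move p x q -> value_le q b).
Proof.
move=> nw t H; case: H nw t => {p b} [p b wp|p x q b c t m Hq cb|p b t ex al] nw t' //.
by case: (@opponent_neq P); congruence.
Qed.

Lemma least_value_rules : value_rules G P (fun p => is_least (value_le p)).
Proof.
move=> p a; have [wp|nw] := pselect (won G P p).
  split=> [[_ la]|[[_ [a0 _]]|[]|[]]//].
    by apply: Or31; split=> //; split; [apply: la; exact: value_le_won|exact: ole0].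
  split; first exact: value_le_won.
  by move=> b _; exact/(ole_trans a0)/ole0.
have [t|t] := turnP (turn p) P.
  split.
    move=> [/(value_le_ownE nw t)[x [q [c [m lc ca]]]] la].
    apply: Or32; split=> //.
    have [b lb bc] : exists2 b,
        is_least (next_values (fun p => is_least (value_le p)) p) b & ole b c.
      by apply: exists_least; exists x, q.
    exists b => //; case: (lb) => -[y [r [m' [Hr _]]]] _; split.
      by apply: la; exact: value_le_own t m' Hr (olt_succ b).
    by apply/ole_succ; exact: ole_olt_trans bc ca.
  move=> [[//]|[_ _ [b [[x [q [m [Hq _]]]] lb] [ab ba]]]|[_ t' _ _ _]]; last first.
    by case: (@opponent_neq P); congruence.
  split; first by apply: value_le_own t m Hq _; exact: olt_ole_trans (olt_succ b) ba.
  move=> d /(value_le_ownE nw t)[y [r [c [m' lc cd]]]].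
  apply: (ole_trans ab); apply/ole_succ; apply: ole_olt_trans cd.
  by apply: lb; exists y, r.
split.
  move=> [/(value_le_opponentE nw t)[ex al] la].
  apply: Or33; split=> //.
    by move=> x q /al /exists_least[b lb _]; exists b.
  split.
    by move=> c [x [q [m [_ lc]]]]; apply: lc; exact: al m.
  move=> d ub; apply: la; apply: value_le_opponent => // x q m.
  have [b lb _] := exists_least (al x q m).
  by case: (lb) => Hb _; apply: value_le_trans Hb _; apply: ub; exists x, q.
move=> [[//]|[_ t' _]|[_ _ ex al [ub lub]]].
  by case: (@opponent_neq P); congruence.
split.
  apply: value_le_opponent => // x q m; have [b lb] := al x q m.
  by case: (lb) => Hb _; apply: value_le_trans Hb _; apply: ub; exists x, q.
move=> d /(value_le_opponentE nw t)[_ al']; apply: lub => c [x [q [m [_ lc]]]].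
exact/lc/(al' x).
Qed.

Lemma game_value_rules : value_rules G P (game_value G P).
Proof.
suff -> : game_value G P = (fun p => is_least (value_le p)).
  exact: least_value_rules.
apply/funext => p; apply/funext => a; apply/propext; split.
  by move=> [V rV Vp]; exact: value_rules_sub rV least_value_rules _ _ Vp.
by move=> H; exists (fun p => is_least (value_le p)) => //; exact: least_value_rules.
Qed.

End Values.

(* Main.v *)
Require Import Defs.
From mathcomp Require Import all_boot.
From mathcomp Require Import boolp classical_sets cardinality.

Set Implicit Arguments.
Unset Strict Implicit.
Unset Printing Implicit Defensive.

Local Open Scope classical_set_scope.

(** Only the set [S] of the stones of [P] matters for the winning condition of [P],
    so a win on finitely many locations is a game with two parameters: [S], and
    the set [F] of those chosen locations that are still free.  [forced S F] is
    the inductive notion that [P], to move, wins it, where the opponent answers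
    each move by taking one location away from [F], or none.  Shrinking [F]
    only hurts [P] ([forced_mono]); this makes strategies for different
    boards comparable.

    A position with a value has a finite set [D] of free locations on which [P]
    wins in this sense ([value_le_forced]), by induction on the value.  The case
    of interest is the opponent's turn, where there may be infinitely many moves.
    Pick one of them, [y0]; it leads to a finite [D0] of free locations, which
    does not contain [y0].  Any answer outside [D0] leaves [P] with the same
    stones and all of [D0] free, so [D0] serves for it as well.  Only the finitely
    many answers [y] in [D0] need sets [D_y] of their own, and [D0] together
    with these is finite and serves for every answer.

    Conversely, a forced win yields a strategy that attends only to [D]
    ([forced_local]): the observations determine the stones of [P] and the free
    locations of [D], so [P] can keep track of both and always play a location
    that keeps the win forced.

    Finally, following such a strategy, each move of [P] uses up a location of
    [D], so the value is at most the size of [D] ([strategy_value]), and an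
    ordinal below a natural number is finite. *)

(** * Moves and free locations *)

Definition add_opt (X : Type) (S : set X) (o : option X) : set X :=
  S `|` [set y | o = Some y].

Definition remove_opt (X : Type) (F : set X) (o : option X) : set X :=
  F `\` [set y | o = Some y].

Section Positions.
Variables (X : Type).
Implicit Types (p q : position X) (Q : player) (S F D : set X) (x y : X).

Definition free D p : set X := D `\` occupied p.

Lemma occupied_stones p Q y :
  occupied p y <-> stones p Q y \/ stones p (opponent Q) y.
Proof.
by rewrite /occupied; case: Q; split=> -[]; [left|right|left|right|right|left|right|left].
Qed.

Lemma move_occupied p x q y : move p x q -> occupied q y <-> y = x \/ occupied p y.
Proof.
move=> [_ sx so _]; rewrite !(occupied_stones _ (turn p)) sx so; split.
  by move=> [[->|]|]; [left|right; left|right; right].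
by move=> [->|[]]; [left; left|left; right|right].
Qed.

Lemma exists_move p x : ~ occupied p x -> exists q, move p x q.
Proof.
move=> nx.
pose st Q : set X := fun y => stones p Q y \/ Q = turn p /\ y = x.
have st_disj : st Red `&` st Blue = set0.
  rewrite predeqE => y; split=> //; rewrite /st => -[[r|[tR yx]] [b|[tB yx']]].
  - by rewrite -(stones_disjoint p).
  - by apply: nx; left; rewrite -yx'.
  - by apply: nx; right; rewrite -yx.
  - by congruence.
exists (Position (opponent (turn p)) st_disj); split=> //=.
  rewrite predeqE => y; split; first by move=> [|[_ ->]]; [right|left].
  by move=> [->|]; [right|left].
rewrite predeqE => y; split; last by left.
by move=> [//|[/opponent_neq]].
Qed.

(** The option [o] tells which location of [D] the move takes: [None] may stand
    for a move outside [D], as in [observe]. *)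
Lemma move_free p x q D o : move p x q -> (D x -> o = Some x) ->
  (forall y, o = Some y -> y = x) -> free D q = remove_opt (free D p) o.
Proof.
move=> m Dx ox; rewrite predeqE => y; split.
  move=> [Dy nq]; split; first by split=> // py; apply/nq/(move_occupied _ m); right.
  by move=> /ox yx; apply/nq/(move_occupied _ m); left.
move=> [[Dy np] oy]; split=> // /(move_occupied _ m)[yx|//].
by subst y; exact/oy/Dx.
Qed.

Lemma free_observe p y q D : move p y q ->
  free D q = remove_opt (free D p) (observe D y).
Proof.
move=> m; apply: move_free m _ _; rewrite /observe; first by case: pselect.
by move=> z; case: pselect => // _ [].
Qed.

Lemma free_own p x q D : move p x q -> free D q = remove_opt (free D p) (Some x).
Proof. by move=> m; apply: move_free m _ _ => // y []. Qed.

End Positions.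

(** * Forced wins on a set of free locations *)

Section Forced.
Variables (X : Type) (G : game X) (P : player).
Implicit Types (p q : position X) (S F D : set X) (x y : X) (o : option X).

(** [P] plays [x], then the opponent takes [o].  With [o = None] the opponent plays
    elsewhere, so the subsequent moves of [P] in [F] come with no answer in [F]. *)
Inductive forced S F : Prop :=
| forced_won W : winning G P W -> W `<=` S -> forced S F
| forced_play x : F x ->
    (forall o, forced (add_opt S (Some x)) (remove_opt (remove_opt F (Some x)) o)) ->
    forced S F.

Lemma forced_mono S F F' : forced S F -> F `<=` F' -> forced S F'.
Proof.
move=> H; elim: H F' => {S F} [S F W wW WS|S F x Fx _ IH] F' FF'.
  exact: forced_won wW WS.
apply: (@forced_play _ _ x); first exact: FF'.
by move=> o; apply: IH; do 2 apply: setSD.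
Qed.

Lemma forced_full S F : forced S F -> F `<=` set0 ->
  exists2 W, winning G P W & W `<=` S.
Proof. by case=> [W ? ? _|x Fx _ F0]; [exists W|case: (F0 x)]. Qed.

(** The set of free locations on which the win is forced, read from a position: when
    the opponent is to move, all his answers have to be survived first. *)
Definition forced_at p D : Prop :=
  (turn p = P -> forced (stones p P) D) /\
  (turn p = opponent P -> forall o, forced (stones p P) (remove_opt D o)).

(** By induction on the value.  That [D] avoids the occupied locations is part of
    the induction: it is what makes the opponent's first move [y0] lie outside
    the set chosen for it, hence irrelevant to the win there. *)
Lemma value_le_forced p (a : Ord) : value_le G P p a ->
  exists D, [/\ finite_set D, D `&` occupied p = set0 & forced_at p D].
Proof.
elim=> {p a} [p a [W wW Wp]|p x q a b t m _ [D [fD Dq [_ fq]]] _|p a t [y0 [q0 m0]] _ IH].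
- exists set0; split; [exact: finite_set0|by rewrite set0I|].
  by split=> *; exact: forced_won wW Wp.
- have Dfree y : D y -> y <> x /\ ~ occupied p y.
    move=> Dy; split=> [yx|py]; have: (D `&` occupied q) y;
      try by rewrite Dq.
    + by split=> //; apply/(move_occupied _ m); left.
    + by split=> //; apply/(move_occupied _ m); right.
  exists (x |` D); split; first by rewrite finite_setU; split.
    rewrite predeqE => y; split=> // -[[->|/Dfree[_ np] //]].
    by case: m.
  split=> tp; last by case: (@opponent_neq P); congruence.
  apply: (@forced_play _ _ x); first by left.
  move=> o; have [_ sx _ tq] := m; rewrite t in sx tq.
  have := fq tq o; rewrite sx => /forced_mono F.
  have -> : add_opt (stones p P) (Some x) = x |` stones p P.
    rewrite setUC; congr setU.
    by rewrite predeqE => y; split=> [[->]|->].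
  (* [x] is occupied in [q], hence not in [D]. *)
  apply: F => y [Dy no]; split; last exact: no.
  by split; [right|move=> -[xy]; case: (Dfree y Dy); rewrite xy].
(* Stated for all [y], with no content when [y] is occupied, so that choice gives a
   total function [E]. *)
have ex y : exists D, [/\ finite_set D, D `&` occupied p = set0, ~ D y &
    ~ occupied p y -> forced (stones p P) D].
  have [py|npy] := pselect (occupied p y).
    by exists set0; split; [exact: finite_set0|rewrite set0I|case|].
  have [q m] := exists_move npy.
  have [D [fD Dq [fq _]]] := IH y q m.
  exists D; split=> //.
  - rewrite predeqE => z; split=> // -[Dz pz]; rewrite -Dq; split=> //.
    by apply/(move_occupied _ m); right.
  - move=> Dy; have: (D `&` occupied q) y; last by rewrite Dq.
    by split=> //; apply/(move_occupied _ m); left.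
  - move=> _; have [_ _ so tq] := m; rewrite t opponentK in so tq.
    by rewrite -so; exact: fq.
have [E EP] := choice ex.
have [fE0 E0p _ F0] := EP y0.
exists (E y0 `|` \bigcup_(y in E y0) E y); split.
- rewrite finite_setU; split=> //; apply: bigcup_finite => // y _.
  by have [] := EP y.
- rewrite predeqE => z; split=> // -[[Ez|[y _ Ez]] pz].
    by rewrite -E0p.
  by have [_ <- _ _] := EP y.
split=> tp; first by case: (@opponent_neq P); congruence.
move=> o.
(* The answer is either in [E y0], where [E y] was prepared for it, or it leaves
   [E y0] untouched. *)
have [[y oy Ey]|no] := pselect (exists2 y, o = Some y & E y0 y).
  have [_ _ nEy Fy] := EP y.
  apply: (@forced_mono _ (E y)); first apply: Fy.
    by move=> py; have: (E y0 `&` occupied p) y; rewrite // E0p.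
  move=> z Ez; split; first by right; exists y.
  by rewrite oy => -[yz]; subst z.
apply: (@forced_mono _ (E y0)); first by apply: F0; case: m0.
move=> z Ez; split; first by left.
by move=> oz; apply: no; exists z.
Qed.

(** * From forced wins to strategies *)

Definition plan S F x : Prop :=
  F x /\ forall o,
    forced (add_opt S (Some x)) (remove_opt (remove_opt F (Some x)) o).

Definition choose_plan S F : option X :=
  if pselect (exists x, plan S F x) is left e then Some (projT1 (cid e)) else None.

Lemma choose_planP S F x : choose_plan S F = Some x -> plan S F x.
Proof.
rewrite /choose_plan; case: pselect => // e [<-].
by case: cid.
Qed.

Lemma choose_plan_forced S F : forced S F ->
  (exists2 W, winning G P W & W `<=` S) \/ exists2 x, choose_plan S F = Some x & F x.
Proof.
case=> [W ? ?|x Fx fx]; first by left; exists W.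
right; rewrite /choose_plan; case: pselect => [e|[]]; last by exists x.
by case: cid => y [] /= Fy _; exists y.
Qed.

(** What [P] knows from the observations when about to move, with the move chosen.
    The first two fields describe the board before the move [next]. *)
Record memory := Memory { mine : set X; left_over : set X; next : option X }.

Definition remember (S F : set X) : memory := Memory S F (choose_plan S F).

Definition update (m : memory) (o : option X) : memory :=
  remember (add_opt (mine m) (next m))
           (remove_opt (remove_opt (left_over m) (next m)) o).

(** When the opponent moves first, [next] is [None], so that the first update adds no
    stone of [P]. *)
Definition start p D : memory :=
  Memory (stones p P) (free D p)
    (if pselect (turn p = P) then choose_plan (stones p P) (free D p) else None).

Definition recall p D (h : seq (option X)) : memory := foldl update (start p D) h.

Definition strategy p D h : option X := next (recall p D h).

(** The memory describes the position reached when [P] is to move; at the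
    opponent's turns the move [next], if there is one, has been played
    since. *)
Lemma recall_play p D h q : forced_at p (free D p) ->
  play P D (strategy p D) p h q ->
  (turn q = P -> recall p D h = remember (stones q P) (free D q) /\
                 forced (stones q P) (free D q)) /\
  (turn q = opponent P -> let m := recall p D h in
    [/\ stones q P = add_opt (mine m) (next m),
        free D q = remove_opt (left_over m) (next m),
        forall x, next m = Some x -> D x &
        forall o, forced (stones q P) (remove_opt (free D q) o)]).
Proof.
move=> [fP fO]; elim=> {h q} [|h q x r _ [IH _] tq sx m|h q y r _ [_ IH] tq m].
- split=> t.
    split; last exact: fP.
    by rewrite /recall /= /start; case: pselect.
  rewrite /recall /= /start; case: pselect => [t'|_] /=.
    by case: (@opponent_neq P); congruence.
  split=> //; last exact: fO.
    by rewrite predeqE => z; split; [left|case].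
  by rewrite predeqE => z; split; [|case].
- have [E F] := IH tq.
  have [_ sr _ tr] := m; rewrite tq in sr tr.
  split=> t; first by case: (@opponent_neq P); congruence.
  move: sx; rewrite /strategy E /= => sx; rewrite sx.
  have [[Dx nx] fx] := choose_planP sx.
  have sE : stones r P = add_opt (stones q P) (Some x).
    by rewrite sr setUC; congr setU; rewrite predeqE => z; split=> [->|[->]].
  split=> //; first exact: free_own m.
    by move=> z [<-].
  by move=> o; rewrite sE (free_own _ m).
- have [E1 E2 _ F] := IH tq.
  have [_ _ so tr] := m; rewrite tq opponentK in so tr.
  split=> t; last by case: (@opponent_neq P); congruence.
  rewrite so (free_observe _ m); split; last exact: F.
  by rewrite /recall foldl_rcons /update -/(recall p D h) -E1 -E2.
Qed.

Lemma forced_local p D : finite_set D -> D `&` occupied p = set0 ->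
  forced_at p D -> intrinsically_local G P p.
Proof.
move=> fD Dp fp; exists D => //; exists (strategy p D) => h q Hq.
have freeE : free D p = D.
  rewrite predeqE => y; split; first by case.
  by move=> Dy; split=> // py; have: (D `&` occupied p) y; rewrite // Dp.
rewrite -freeE in fp.
have [IP IO] := recall_play fp Hq.
have [t|t] := turnP (turn q) P.
  have [E F] := IP t; rewrite /strategy E /=; split.
  - by move=> x /choose_planP[[]].
  - move=> _ nw; have [//|[x cx [Dx nx]]] := choose_plan_forced F.
    by exists x.
  - by move=> full; apply: forced_full F _ => y [/full].
have [E1 E2 ED F] := IO t; split=> //.
  by move=> t'; case: (@opponent_neq P); congruence.
by move=> full; apply: forced_full (F None) _ => y [[/full]].
Qed.

End Forced.

(** * Finiteness of the value *)

(** The list [e] covers the free locations of [D], and each move of [P] takes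
    one of its entries; the opponent's moves are not counted, as the value is a
    supremum at his turns.  Before [P] has won, [D] is not filled, so the opponent
    always has a legal move, as the definition of the value requires. *)
Lemma strategy_value (X : choiceType) (G : game X) (P : player) (p : position X)
    (D : set X) (s : seq (option X) -> option X) :
  (forall h q, play P D s p h q ->
    [/\ forall x, s h = Some x -> D x,
        turn q = P -> ~ won G P q -> exists2 x, s h = Some x & ~ occupied q x &
        D `<=` occupied q -> won G P q]) ->
  forall n h q (e : seq X), play P D s p h q -> size e <= n ->
  (forall y, free D q y -> y \in e) -> value_le G P q (ord_of_nat n).
Proof.
move=> win.
have opp n h q : play P D s p h q -> turn q = opponent P ->
    (forall y r, move q y r -> value_le G P r (ord_of_nat n)) ->
    value_le G P q (ord_of_nat n).
  move=> Hq t next_le; have [wq|nwq] := pselect (won G P q).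
    exact: value_le_won.
  apply: value_le_opponent => //.
  have [_ _ full] := win h q Hq.
  have /existsNP[y /not_implyP[_ ny]] : ~ (D `<=` occupied q).
    by move=> /full.
  have [r m] := exists_move ny.
  by exists y, r.
have own n : forall h q (e : seq X), play P D s p h q -> turn q = P -> size e <= n ->
    (forall y, free D q y -> y \in e) -> value_le G P q (ord_of_nat n).
  elim: n => [|n IH] h q e Hq t se De;
    have [wq|nwq] := pselect (won G P q); try exact: value_le_won;
    have [sD /(_ t nwq)[x sx nx] _] := win h q Hq;
    have xe : x \in e by apply: De; split=> //; exact: sD.
    by move: se xe; case: e {De}.
  have [r m] := exists_move nx.
  have Hr : play P D s p h r by exact: play_own Hq t sx m.
  have tr : turn r = opponent P by case: m => _ _ _ ->; rewrite t.
  apply: (value_le_own (b := ord_of_nat n) t m); last exact: olt_succ.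
  apply: (opp n h) => // y r' m'.
  have Hr' := play_opponent Hr tr m'.
  apply: (IH _ _ (rem x e) Hr').
  - by case: m' => _ _ _ ->; rewrite tr opponentK.
  - by rewrite size_rem //; case: (size e) se.
  - move=> z [Dz nz].
    have nrz : ~ occupied r z by move=> rz; apply/nz/(move_occupied _ m'); right.
    have ze : z \in e.
      by apply: De; split=> // qz; apply/nrz/(move_occupied _ m); right.
    have zx : z != x.
      by apply/eqP => zx; apply/nrz/(move_occupied _ m); left.
    by have := perm_to_rem xe => /perm_mem/(_ z); rewrite ze inE (negPf zx).
move=> n h q e Hq se De; have [t|t] := turnP (turn q) P; first exact: own Hq t se De.
apply: (opp n h) => // y r m; apply: (own n _ _ e (play_opponent Hq t m)) => //.
  by case: m => _ _ _ ->; rewrite t opponentK.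
move=> z [Dz nz]; apply: De; split=> // qz.
by apply/nz/(move_occupied _ m); right.
Qed.

Lemma local_value_finite (X : Type) (G : game X) (P : player) (p : position X) :
  intrinsically_local G P p -> exists n, value_le G P p (ord_of_nat n).
Proof.
elim/Pchoice: X => X in G p *.
move=> [D /finite_seqP[e De] [s win]]; exists (size e).
apply: (strategy_value win (play_start _ _ _ _) (leqnn _)).
by move=> y [Dy _]; rewrite De in Dy.
Qed.

Lemma ole_nat_finite (a : Ord) n : ole a (ord_of_nat n) -> finite_ord a.
Proof.
elim: n => [|n IH] an; first by exists 0; split=> //; exact: ole0.
have [/IH//|na] := (ole_total a (ord_of_nat n)).1.
by exists n.+1; split=> //; exact/ole_succ.
Qed.

Theorem theorem19 (X : Type) (G : game X) (P : player) (p : position X) (a : Ord) :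
  game_value G P p a -> intrinsically_local G P p /\ finite_ord a.
Proof.
move=> [V rV Vp].
have [pa a_least] := value_rules_sub rV (least_value_rules G P) Vp.
have [D [fD Dp fp]] := value_le_forced pa.
have loc := forced_local fD Dp fp; split=> //.
have [n pn] := local_value_finite loc.
exact: ole_nat_finite (a_least _ pn).
Qed.
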